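(* Let $p$ be an odd prime and $n\ge1$. The local normalizing graph of $G=\mathbb{Z}/p^n\mathbb{Z}$ contains the following connected components. (i) The clique $H$, composed of $p^{n-\lceil n/2\rceil}$ regular subgroups. (ii) $\frac{1}{p+1}\left(p^{n-1}-p^{n-2\lceil n/2\rceil+1}\right)$ connected components $A_u^{t,c}$, for $1\le u<\lceil n/2\rceil$, $0\le t<p^{n-2u-1}$ and $1\le c<p$, each of which is a clique composed of $p^u$ regular subgroups.
   Context: Maps act on the right: $x^\alpha$ is the image of $x$ under $\alpha$, and products of permutations are composed left to right. $G=\mathbb{Z}/p^n\mathbb{Z}$ is written additively; $\sigma_k\colon x\mapsto kx$. $\rho(g)\colon x\mapsto x+g$, and $\mathrm{Hol}(G)=\langle\rho(G),\mathrm{Aut}(G)\rangle\le\mathrm{Sym}(G)$. The local normalizing graph of $G$ is the undirected graph whose vertices are the regular subgroups of $\mathrm{Hol}(G)$ (subgroups acting regularly on the set $G$), two distinct vertices being joined by an edge if and only if they mutually normalize each other, i.e. each is contained in the normalizer of the other in $\mathrm{Sym}(G)$. A gamma function on $G$ is a map $\gamma\colon G\to\mathrm{Aut}(G)$ with $\gamma(g^{\gamma(h)}+h)=\gamma(g)\gamma(h)$ for all $g,h$. Regular subgroups of $\mathrm{Hol}(G)$ correspond bijectively to gamma functions via $N=\{\gamma(g)\rho(g):g\in G\}$; sets of gamma functions are identified with the sets of the associated regular subgroups. For $1\le u\le n$ let $\gamma_u(x)=\sigma_{p^ux+1}$, a gamma function on $G$ (with $\gamma_n$ trivial). For $0\le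 k<p^{n-1}$ and $1\le c<p$ let $\gamma_u^{k,c}(x)=\gamma_u((kp+c)x)$; this is the gamma function of the conjugate of the regular subgroup of $\gamma_u$ under $\sigma_{kp+c}^{-1}\in\mathrm{Aut}(G)$. Set $$H=\{\gamma_u^{k,c}:\lceil n/2\rceil\le u\le n,\ 0\le k<p^{n-1},\ 1\le c<p\},$$ $$A_u^{t,c}=\{\gamma_u^{k,c}: 0\le k<p^{n-1},\ k\equiv t\pmod{p^{n-2u-1}}\}.$$ A clique is a complete subgraph. *)

(* Defs.v *)
From mathcomp Require Export all_boot all_order all_fingroup all_algebra.
From mathcomp Require Import ring.

Set Implicit Arguments.
Unset Strict Implicit.
Unset Printing Implicit Defensive.

Import GRing.Theory.

(* Products in {perm T} compose left to right: (s * t) x = t (s x), and the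
   image of x under the right action of s is s x. *)

Section Holomorph.
Variable G : finZmodType.
Local Open Scope group_scope.

Definition rho (g : G) : {perm G} := perm (addIr g).

Definition Hol : {group {perm G}} :=
  <<(rho @: [set: G]) :|: Aut [set: G]>>%G.

Definition regular (N : {group {perm G}}) : bool :=
  [transitive N, on [set: G] | 'P] && [forall x : G, 'C_N[x | 'P] == 1].

(* Subgroups are recorded through their underlying sets of permutations. *)
Definition lng_vertices : {set {set {perm G}}} :=
  [set gval N | N : {group {perm G}} & (N \subset Hol) && regular N].

Definition lng_edge : rel {set {perm G}} := fun M N =>
  [&& M \in lng_vertices, N \in lng_vertices, M != N,
      M \subset 'N(N)%g & N \subset 'N(M)%g].

Definition lng_component (C : {set {set {perm G}}}) : Prop :=
  exists2 N, N \in lng_vertices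
           & C = [set M in lng_vertices | connect lng_edge N M].

Definition lng_clique (C : {set {set {perm G}}}) : Prop :=
  C \subset lng_vertices /\ {in C &, forall M N, M != N -> lng_edge M N}.

Definition gamma_function (gam : {ffun G -> {perm G}}) : Prop :=
  (forall g, gam g \in Aut [set: G]) /\
  (forall g h, gam (gam h g + h)%R = gam g * gam h)%g.

Definition gamma_subgroup (gam : {ffun G -> {perm G}}) : {set {perm G}} :=
  [set (gam g * rho g)%g | g : G].

Lemma gamma_subgroup_group_set gam :
  gamma_function gam -> group_set (gamma_subgroup gam).
Proof.
case=> gamA gamM; have mor g x y : gam g (x + y)%R = (gam g x + gam g y)%R.
  by have /morphicP := Aut_morphic (gamA g); apply; rewrite inE.
have gam0 : gam 0%R = 1%g.
  have g0 : gam 0%R 0%R = 0%R by apply: (addrI (gam 0%R 0%R)); rewrite -mor !addr0.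
  by apply: (mulgI (gam 0%R)); rewrite -gamM g0 addr0 mulg1.
apply/group_setP; split=> [|_ _ /imsetP[g _ ->] /imsetP[h _ ->]].
  apply/imsetP; exists 0%R => //; rewrite gam0 mul1g.
  by apply/permP=> x; rewrite perm1 permE /= addr0.
apply/imsetP; exists (gam h g + h)%R => //; rewrite gamM.
by apply/permP=> x; rewrite !permM !permE /= mor addrA.
Qed.

End Holomorph.

Section CyclicPrimePower.
Variables p n : nat.
Local Notation G := 'Z_(p ^ n).
Local Open Scope ring_scope.

(* x |-> k x; junk value the identity when k is not a unit, in which case
   this map is not a permutation. *)
Definition sigma (k : G) : {perm G} := insubd (1%g : {perm G}) [ffun x => k * x].

Definition gamma_u (u : nat) : {ffun G -> {perm G}} :=
  [ffun x => sigma ((p ^ u)%:R * x + 1)].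

Definition gamma_ukc (u k c : nat) : {ffun G -> {perm G}} :=
  [ffun x => gamma_u u ((k * p + c)%:R * x)].

(* uphalf n = ceil(n/2) *)
Definition H_gammas : {set {ffun G -> {perm G}}} :=
  [set gam | [exists u : 'I_n.+1, exists k : 'I_(p ^ n.-1), exists c : 'I_p,
    [&& uphalf n <= u, 0 < c & gam == gamma_ukc u k c]%N]].

Definition A_gammas (u t c : nat) : {set {ffun G -> {perm G}}} :=
  [set gamma_ukc u k c
     | k : 'I_(p ^ n.-1) & (k == t %[mod p ^ (n - 2 * u - 1)])%N].

Definition H_subgroups : {set {set {perm G}}} :=
  @gamma_subgroup _ @: H_gammas.

Definition A_subgroups (u t c : nat) : {set {set {perm G}}} :=
  @gamma_subgroup _ @: A_gammas u t c.

Definition A_family : {set {set {set {perm G}}}} :=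
  [set C | [exists u : 'I_(uphalf n), exists t : 'I_(p ^ (n - 2 * u - 1)),
    exists c : 'I_p, [&& 0 < u, 0 < c & C == A_subgroups u t c]%N]].

Lemma sigmaE (k x : G) : k \is a GRing.unit -> sigma k x = k * x.
Proof.
move=> Uk; have injk : injectiveb [ffun y : G => k * y].
  by apply/injectiveP=> y z; rewrite !ffunE; apply: mulrI.
by rewrite -pvalE /sigma /insubd insubT /= ffunE.
Qed.

Lemma gamma_u_unit (u : nat) (x : G) :
  prime p -> (0 < n)%N -> (0 < u)%N ->
  (p ^ u)%:R * x + 1 \is a GRing.unit.
Proof.
move=> p_pr n_gt0 u_gt0; have p_gt1 := prime_gt1 p_pr.
have pn_gt1 : (1 < p ^ n)%N by rewrite -(exp1n n) ltn_exp2r.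
set a := _ * x; have an0 : (- a) ^+ n = 0.
  have pn0 : (p ^ n)%:R = 0 :> G by exact: pchar_Zp.
  rewrite exprNn /a exprMn -natrX -expnM -(subnK (leq_pmull n u_gt0)) expnD.
  by rewrite natrM pn0 mulr0 mul0r mulr0.
have := subrX1 (- a) n; rewrite an0 sub0r => /(congr1 -%R).
rewrite opprK -mulNr opprB opprK addrC => e.
by apply/unitrPr; exists (\sum_(i < n) (- a) ^+ i).
Qed.

Lemma gamma_ukc_gamma_function (u k c : nat) :
  prime p -> (0 < n)%N -> (0 < u)%N -> gamma_function (gamma_ukc u k c).
Proof.
move=> p_pr n_gt0 u_gt0.
have gE g x : gamma_ukc u k c g x = ((p ^ u)%:R * ((k * p + c)%:R * g) + 1) * x.
  by rewrite !ffunE sigmaE // gamma_u_unit.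
split=> [g|g h].
  rewrite inE; apply/andP; split; first by apply/subsetP=> x; rewrite inE.
  by apply/morphicP=> x y _ _; rewrite !gE mulrDr.
by apply/permP=> x; rewrite permM !gE; ring.
Qed.

End CyclicPrimePower.

(* Main.v *)
Require Import Defs.
From mathcomp Require Import cyclic ring zify.

Set Implicit Arguments.
Unset Strict Implicit.
Unset Printing Implicit Defensive.

Import GRing.Theory.

(** The vertices and the edges of the graph become explicit once every regular
    subgroup is described by one residue. For a in pG write N_a for the group
    of all maps x |-> (a g + 1) x + g with g in G.

    Every vertex is some N_a ([lng_vertexP]). A regular N has order p^n and
    contains a unique s sending 0 to 1, of the form x |-> m x + 1. As s^(p^n) = 1, the
    multiplier satisfies m^(p^n) = 1, so m = 1 modulo p by Fermat. The k-th
    power of s is x |-> m^k x + g_k with g_k = 1 + m + ... + m^(k-1); for p odd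
    the residues g_k, k < p^n, are distinct ([dvdn_geometric_sum]), hence
    exhaust G. Since m^k = (m - 1) g_k + 1, the powers of s are exactly the
    elements of N_(m - 1).

    Conjugating the element of N_b with parameter g by the element of N_a with
    parameter h keeps its multiplier b g + 1 and moves its translation part to
    g + (a - b) g h. So N_a normalizes N_b iff b (b - a) = 0, and distinct N_a
    and N_b are adjacent iff a (b - a) = b (b - a) = 0
    ([affine_subgroup_edge]).

    It remains to solve these equations modulo p^n. If a = p^u w with w a unit
    and 2u < n, they say that b is in a + p^(n-u) G, and every element of that
    coset is again p^u times a unit; this coset is the parameter set of
    A_u^(t,c) when a = p^u (tp + c). If a is in p^m G with m = ceil(n/2), then
    subtracting the equations gives (b - a)^2 = 0, so b is in p^m G as well,
    and any two elements of p^m G have product 0; this ideal is the parameter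
    set of H. In both cases the set of parameters is a clique closed under
    adjacency, that is, a component ([affine_family_component]). All
    cardinalities are those of ideals and cosets of G, and the number of the
    A_u^(t,c) is a geometric sum. *)

(** * Geometric sums modulo powers of an odd prime *)

Lemma geometric_sumD (R : pzSemiRingType) (x : R) (i j : nat) :
  (\sum_(l < i + j) x ^+ l =
     \sum_(l < i) x ^+ l + x ^+ i * \sum_(l < j) x ^+ l)%R.
Proof.
rewrite big_split_ord /= mulr_sumr; congr (_ + _)%R.
by apply: eq_bigr => l _; rewrite exprD.
Qed.

(** Both are binomial expansions truncated modulo p^2; the induction on k that
    gives the sum needs the expansion of each power. *)
Lemma geometric_sum_expansion (b p k : nat) :
  exists x y : nat, (b * p + 1) ^ k = 1 + k * b * p + p ^ 2 * x /\
    \sum_(i < k) (b * p + 1) ^ i = k + 'C(k, 2) * b * p + p ^ 2 * y.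
Proof.
elim: k => [|k [x [y [Ex Ey]]]].
  by exists 0, 0; rewrite big_ord0 !mul0n muln0.
exists (x + k * b * b + x * b * p), (x + y); rewrite big_ord_recr /= expnSr Ex Ey.
rewrite binS bin1; split; ring.
Qed.

(** The sum is p + C(p, 2) b p modulo p^2, and p divides C(p, 2) because p is
    odd; for p = 2 and m = 3 the sum is 4. *)
Lemma geometric_sum_prime (p m : nat) :
  prime p -> odd p -> m = 1 %[mod p] ->
  exists2 q : nat, \sum_(i < p) m ^ i = p * q & ~~ (p %| q).
Proof.
move=> p_pr p_odd m1; have p_gt1 := prime_gt1 p_pr.
have p_gt2 : 2 < p by apply: odd_prime_gt2.
have -> : m = m %/ p * p + 1 by rewrite {1}(divn_eq m p) m1 modn_small.
have [x [y [_ ->]]] := geometric_sum_expansion (m %/ p) p p.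
have /dvdnP[c ->] : p %| 'C(p, 2) by rewrite prime_dvd_bin.
exists (1 + p * (c * (m %/ p) + y)); first by ring.
by rewrite dvdn_addl ?dvdn_mulr // dvdn1 neq_ltn p_gt1 orbT.
Qed.

(** A case of lifting the exponent. Modulo p the sum is k, so k = p k' as soon
    as e > 0; grouping the terms by p factors the sum as the sum of p terms,
    exactly divisible by p, times a sum of k' powers of m^p, to which the
    induction applies. *)
Lemma dvdn_geometric_sum (p m e k : nat) :
  prime p -> odd p -> m = 1 %[mod p] ->
  p ^ e %| \sum_(i < k) m ^ i -> p ^ e %| k.
Proof.
move=> p_pr p_odd; elim: e m k => [|e IHe] m k m1 dv; first exact: dvd1n.
have exp1 j : m ^ j = 1 %[mod p] by rewrite -modnXm m1 modnXm exp1n.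
have sum_k : \sum_(i < k) m ^ i = k %[mod p].
  rewrite -modn_summ (eq_bigr (fun=> 1 %% p)); last by move=> i _; apply: exp1.
  by rewrite modn_summ sum1_card card_ord.
have /dvdnP[k' Dk] : p %| k.
  by rewrite /dvdn -sum_k; apply: dvdn_trans dv; rewrite expnS dvdn_mulr.
have sum_pk : \sum_(i < k) m ^ i
    = (\sum_(i < p) m ^ i) * \sum_(j < k') (m ^ p) ^ j.
  rewrite {}Dk; elim: k' => [|l IHl]; first by rewrite !big_ord0 muln0.
  have natE h : \sum_(i < h) m ^ i = (\sum_(i < h) m ^+ i)%R :> nat.
    by apply: eq_bigr => i _; rewrite natrXE.
  rewrite mulSn addnC natE geometric_sumD -!natE IHl big_ord_recr /=.
  by rewrite mulnDr natrXE -expnM (mulnC p l) [X in _ + X]mulnC.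
have [q Eq q'p] := geometric_sum_prime p_pr p_odd m1.
move: dv; rewrite sum_pk Eq expnS -mulnA dvdn_pmul2l ?prime_gt0 //.
rewrite Gauss_dvdr ?coprimeXl ?prime_coprime // => /(IHe _ _ (exp1 p)).
by rewrite Dk mulnC dvdn_pmul2r ?prime_gt0.
Qed.

Lemma dvdn_square (p n x : nat) :
  prime p -> p ^ n %| x ^ 2 -> p ^ uphalf n %| x.
Proof.
move=> p_pr; have [->|x_gt0] := posnP x; first by rewrite dvdn0.
rewrite !pfactor_dvdn ?expn_gt0 ?x_gt0 // lognX; lia.
Qed.

(** * Regular subgroups over a finite abelian group *)

Section RegularSubgroups.
Variable G : finZmodType.
Local Open Scope group_scope.

Lemma Aut_zmodD (s : {perm G}) :
  s \in Aut [set: G] -> {morph s : x y / (x + y)%R}.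
Proof. by move/Aut_morphic/morphicP=> sM x y; apply: sM; rewrite inE. Qed.

Lemma Aut_zmod0 (s : {perm G}) : s \in Aut [set: G] -> s 0%R = 0%R.
Proof.
by move/Aut_zmodD=> sD; apply: (addrI (s 0%R)); rewrite -sD !addr0.
Qed.

Lemma card_regular (N : {group {perm G}}) : regular N -> #|N| = #|G|.
Proof.
case/andP=> trN /forallP/(_ 0%R)/eqP st.
rewrite -(card_orbit_stab 'P N (0%R : G)) st cards1 muln1.
by rewrite (atransP trN) ?inE // cardsT.
Qed.

Lemma transitive_card_regular (N : {group {perm G}}) :
  [transitive N, on [set: G] | 'P] -> #|N| = #|G| -> regular N.
Proof.
move=> trN oN; rewrite /regular trN; apply/forallP=> x.
have := card_orbit_stab 'P N x; rewrite (atransP trN) ?inE // cardsT oN.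
move/eqP.
have G_gt0 : 0 < #|G| by apply/card_gt0P; exists x.
by rewrite -[X in _ == X]muln1 eqn_pmul2l // trivg_card1.
Qed.

Lemma card_gamma_subgroup (gam : {ffun G -> {perm G}}) :
  gamma_function gam -> #|gamma_subgroup gam| = #|G|.
Proof.
case=> gamA _; rewrite card_imset // => g h /permP/(_ 0%R).
by rewrite !permM !permE !Aut_zmod0 // !add0r.
Qed.

(** The element of index g sends 0 to g, which gives transitivity. The
    stabilizers are then trivial by cardinality. *)
Lemma gamma_subgroup_vertex (gam : {ffun G -> {perm G}}) :
  gamma_function gam -> gamma_subgroup gam \in lng_vertices G.
Proof.
move=> gam_fun; have [gamA gamM] := gam_fun.
pose N := group (gamma_subgroup_group_set gam_fun).
apply/imsetP; exists N => //; rewrite inE; apply/andP; split.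
  apply/subsetP=> _ /imsetP[g _ ->]; apply: groupM; apply: mem_gen.
    by rewrite inE gamA orbT.
  by rewrite inE imset_f.
apply: transitive_card_regular; last exact: card_gamma_subgroup.
apply/imsetP; exists 0%R; rewrite ?inE //; apply/esym/setP=> g.
rewrite !inE; apply/orbitP.
exists (gam g * rho g); first by apply: imset_f.
by rewrite /= apermE permM permE Aut_zmod0 // add0r.
Qed.

Lemma lng_edge_sym : symmetric (@lng_edge G).
Proof.
move=> M N; rewrite /lng_edge eq_sym; do 2!case: (_ \in _) => //=.
by rewrite [X in _ && X]andbC.
Qed.

Lemma lng_component_clique (C : {set {set {perm G}}}) (N : {set {perm G}}) :
    N \in C -> lng_clique C ->
    {in C, forall M M', lng_edge M M' -> M' \in C} -> lng_component C.
Proof.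
move=> CN [CV edgeC] closedC; exists N; first exact: (subsetP CV).
have clC : closed (@lng_edge G) (mem C).
  apply: (intro_closed (sym_connect_sym lng_edge_sym)) => M M' e CM.
  exact: closedC CM _ e.
apply/setP=> M; rewrite inE; apply/idP/andP=> [CM|[_ /(closed_connect clC) E]].
  split; first exact: (subsetP CV).
  have [->|neq] := eqVneq N M; first exact: connect0.
  by apply/connect1/edgeC.
exact: etrans (esym E) CN.
Qed.

End RegularSubgroups.

(** * The ideals of Z/p^n *)

Section Cyclic.
Variables p n : nat.
Hypotheses (p_pr : prime p) (p_odd : odd p) (n_gt0 : 0 < n).
Local Notation G := 'Z_(p ^ n).
Local Open Scope ring_scope.

Let p_gt1 : (1 < p)%N := prime_gt1 p_pr.
Let p_gt0 : (0 < p)%N := prime_gt0 p_pr.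
Let pn_gt1 : (1 < p ^ n)%N.
Proof. by rewrite -(exp1n n) ltn_exp2r. Qed.

Definition pmultiples (k : nat) : {set G} := [set (p ^ k)%:R * x | x : G].

Lemma natr_Zpn (x : G) : (x : nat)%:R = x.
Proof. exact: natr_Zp. Qed.

Lemma natr_eqZ (i j : nat) : (i%:R == j%:R :> G) = (i == j %[mod p ^ n])%N.
Proof. by rewrite -val_eqE /= !val_Zp_nat. Qed.

Lemma natr_eq0Z (i : nat) : (i%:R == 0 :> G) = (p ^ n %| i)%N.
Proof. by rewrite (natr_eqZ i 0) mod0n. Qed.

(** The bound k <= n is what makes divisibility of a representative by p^k
    independent of the representative. *)
Lemma mem_natr_pmultiples (k i : nat) :
  (k <= n)%N -> (i%:R \in pmultiples k) = (p ^ k %| i)%N.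
Proof.
move=> le_kn; apply/imsetP/idP=> [[x _ /eqP]|/dvdnP[j ->]]; last first.
  by exists j%:R; rewrite // mulnC natrM.
rewrite -[x]natr_Zpn -natrM natr_eqZ => /eqP E.
have dk : (p ^ k %| p ^ n)%N by rewrite dvdn_exp2l.
by rewrite /dvdn -(modn_dvdm i dk) E modn_dvdm // modnMr.
Qed.

Lemma pmultiplesD k : {in pmultiples k &, forall x y, x + y \in pmultiples k}.
Proof.
by move=> _ _ /imsetP[x _ ->] /imsetP[y _ ->]; rewrite -mulrDr imset_f.
Qed.

Lemma pmultiplesB k : {in pmultiples k &, forall x y, x - y \in pmultiples k}.
Proof.
by move=> _ _ /imsetP[x _ ->] /imsetP[y _ ->]; rewrite -mulrBr imset_f.
Qed.

Lemma pmultiplesBC k x y : (x - y \in pmultiples k) = (y - x \in pmultiples k).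
Proof.
by apply/imsetP/imsetP=> -[z _ E]; exists (- z); rewrite // mulrN -E opprB.
Qed.

Lemma pmultiples0 k : 0 \in pmultiples k.
Proof. by apply/imsetP; exists 0; rewrite ?mulr0. Qed.

Lemma sub_pmultiples j k : (j <= k)%N -> {subset pmultiples k <= pmultiples j}.
Proof.
move=> le_jk _ /imsetP[x _ ->]; rewrite -(subnKC le_jk) expnD natrM -mulrA.
exact: imset_f.
Qed.

Lemma mem_natrB_pmultiples (k i j : nat) : (k <= n)%N ->
  (i%:R - j%:R \in pmultiples k) = (i == j %[mod p ^ k])%N.
Proof.
move=> le_kn; wlog le_ji : i j / (j <= i)%N.
  by move=> IH; case/orP: (leq_total j i) => /IH // E; rewrite pmultiplesBC E eq_sym.
by rewrite -natrB // mem_natr_pmultiples // eqn_mod_dvd.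
Qed.

Lemma pmultiplesMr (k l : nat) (x : G) : (k + l <= n)%N ->
  ((p ^ k)%:R * x \in pmultiples (k + l)) = (x \in pmultiples l).
Proof.
move=> le_n; rewrite -[x]natr_Zpn -natrM !mem_natr_pmultiples //.
  by rewrite expnD dvdn_pmul2l // expn_gt0 p_gt0.
exact: leq_trans (leq_addl _ _) le_n.
Qed.

Lemma pmultiplesn (x : G) : (x \in pmultiples n) = (x == 0).
Proof. by rewrite -[x]natr_Zpn mem_natr_pmultiples // natr_eq0Z. Qed.

Lemma pmultiplesE (k : nat) :
  (k <= n)%N -> pmultiples k = [set (p ^ k * i)%:R | i : 'I_(p ^ (n - k))].
Proof.
move=> le_kn; apply/setP=> a; apply/idP/imsetP=> [|[i _ ->]]; last first.
  by rewrite natrM imset_f.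
rewrite -[a]natr_Zpn mem_natr_pmultiples // => /dvdnP[j Da].
have ltj : (j < p ^ (n - k))%N.
  rewrite -(@ltn_pmul2r (p ^ k)) ?expn_gt0 ?p_gt0 // -expnD subnK // -Da.
  by have := ltn_ord a; rewrite [X in (_ < X)%N]Zp_cast.
by exists (Ordinal ltj) => //=; rewrite Da mulnC.
Qed.

Lemma card_pmultiples (k : nat) : (k <= n)%N -> #|pmultiples k| = (p ^ (n - k))%N.
Proof.
move=> le_kn; rewrite pmultiplesE // card_imset ?card_ord // => i j /eqP.
have pk_gt0 : (0 < p ^ k)%N by rewrite expn_gt0 p_gt0.
have Dpn : (p ^ n = p ^ k * p ^ (n - k))%N by rewrite -expnD subnKC.
rewrite natr_eqZ Dpn -!muln_modr eqn_pmul2l //.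
by rewrite !modn_small // => /eqP/val_inj.
Qed.

(** * The affine subgroups *)

(** This is N_a only for a in pG: otherwise some a x + 1 may fail to be a unit,
    and sigma then takes its junk value. *)
Definition affine_subgroup (a : G) : {set {perm G}} :=
  gamma_subgroup [ffun x => sigma (a * x + 1)].

Lemma affine_subgroup_ukc u k c :
  gamma_subgroup (gamma_ukc p n u k c)
    = affine_subgroup ((p ^ u)%:R * (k * p + c)%:R).
Proof.
by congr (gamma_subgroup _); apply/ffunP=> x; rewrite !ffunE mulrA.
Qed.

(** The residue a is p b, and every b is kp + c for some k and c, so this gamma
    function is one of the gamma_1^(k,c). *)
Lemma gamma_function_affine (a : G) : a \in pmultiples 1 ->
  gamma_function [ffun x => sigma (a * x + 1)].
Proof.
case/imsetP=> b _ ->.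
have := gamma_ukc_gamma_function (b %/ p) (b %% p) p_pr n_gt0 (ltn0Sn 0).
rewrite /gamma_ukc -divn_eq natr_Zpn.
by congr gamma_function; apply/ffunP=> x; rewrite !ffunE mulrA.
Qed.

Lemma affine_subgroup_vertex (a : G) :
  a \in pmultiples 1 -> affine_subgroup a \in lng_vertices G.
Proof. by move/gamma_function_affine; apply: gamma_subgroup_vertex. Qed.

Lemma affine_eltE (a g x : G) : a \in pmultiples 1 ->
  (([ffun y => sigma (a * y + 1)] g : {perm G}) * rho g)%g x
    = (a * g + 1) * x + g.
Proof.
case/imsetP=> b _ ->.
by rewrite permM permE /= ffunE sigmaE // -mulrA gamma_u_unit.
Qed.

Lemma mem_affine_subgroup (a : G) (s : {perm G}) : a \in pmultiples 1 ->
  reflect (exists g, forall x, s x = (a * g + 1) * x + g)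
          (s \in affine_subgroup a).
Proof.
move=> pa; apply: (iffP imsetP) => [[g _ ->]|[g Ds]].
  by exists g => x; rewrite affine_eltE.
by exists g => //; apply/permP=> x; rewrite affine_eltE ?Ds.
Qed.

Lemma affine_subgroup_elt (a g : G) : a \in pmultiples 1 ->
  exists2 s, s \in affine_subgroup a & forall x, s x = (a * g + 1) * x + g.
Proof.
move=> pa; exists ([ffun y => sigma (a * y + 1)] g * rho g)%g => [|x].
  exact: imset_f.
exact: affine_eltE.
Qed.

(** The element of N_a sending 0 to 1 has multiplier a + 1. *)
Lemma affine_subgroup_inj : {in pmultiples 1 &, injective affine_subgroup}.
Proof.
move=> a b pa pb eqN; have [s sa Ds] := affine_subgroup_elt 1 pa.
move: sa; rewrite eqN => /(mem_affine_subgroup _ pb)[g Ds'].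
have := Ds' 0; rewrite Ds !mulr0 !add0r => g1.
by have := Ds' 1; rewrite Ds -g1 !mulr1 => /addIr/addIr.
Qed.

(** The conjugate of the element of N_b with parameter g by the element of N_a
    with parameter h has multiplier b g + 1 and sends 0 to
    g' = g + (a - b) g h. It lies in N_b iff b g' = b g, and g = h = 1 is the
    most restrictive case. *)
Lemma affine_subgroup_norm (a b : G) :
    a \in pmultiples 1 -> b \in pmultiples 1 ->
  (affine_subgroup a \subset 'N(affine_subgroup b)%g) = (b * (b - a) == 0).
Proof.
move=> pa pb.
have conjE h g (s t : {perm G}) :
    (forall x, s x = (a * h + 1) * x + h) ->
    (forall x, t x = (b * g + 1) * x + g) ->
  forall x, (t ^ s)%g x = (b * g + 1) * x + (g + (a - b) * g * h).
  move=> Ds Dt x; rewrite -[x](permKV s) conjgE !permM permK.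
  by rewrite !(Ds, Dt); ring.
apply/subsetP/eqP=> [nab | ba0 s /(mem_affine_subgroup _ pa)[h Ds]]; last first.
  rewrite inE; apply/subsetP=> _ /imsetP[t /(mem_affine_subgroup _ pb)[g Dt] ->].
  apply/(mem_affine_subgroup _ pb); exists (g + (a - b) * g * h) => x.
  have -> : b * (g + (a - b) * g * h) = b * g - b * (b - a) * g * h by ring.
  by rewrite ba0 !mul0r subr0 (conjE _ _ _ _ Ds Dt).
have [s sa Ds] := affine_subgroup_elt 1 pa.
have [t tb Dt] := affine_subgroup_elt 1 pb.
have := nab s sa; rewrite inE => /subsetP/(_ (t ^ s)%g).
rewrite memJ_conjg => /(_ tb)/(mem_affine_subgroup _ pb)[g Dts].
have E := conjE _ _ _ _ Ds Dt.
have Dg : g = 1 + (a - b) by have := Dts 0; rewrite E !mulr0 !add0r !mulr1.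
have := Dts 1; rewrite E Dg !mulr1 => /addIr/addIr.
by rewrite mulrDr mulr1 -[LHS]addr0 => /addrI/esym/(congr1 -%R); rewrite oppr0 -mulrN opprB.
Qed.

Lemma affine_subgroup_edge (a b : G) :
    a \in pmultiples 1 -> b \in pmultiples 1 ->
  lng_edge (affine_subgroup a) (affine_subgroup b)
    = [&& a != b, a * (b - a) == 0 & b * (b - a) == 0].
Proof.
move=> pa pb; rewrite /lng_edge !affine_subgroup_vertex //=.
rewrite !affine_subgroup_norm // (inj_in_eq affine_subgroup_inj) //.
by rewrite -(opprB b a) mulrN oppr_eq0 [X in _ && X]andbC.
Qed.

(** * Every regular subgroup of the holomorph is affine *)

Lemma Aut_mul (s : {perm G}) : s \in Aut [set: G] -> forall x, s x = s 1 * x.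
Proof.
move=> sA x; rewrite -[in LHS](natr_Zpn x) -[in RHS](natr_Zpn x).
elim: (x : nat) => [|k IHk]; first by rewrite mulr0 Aut_zmod0.
by rewrite -natr1 Aut_zmodD // IHk mulrDr mulr1.
Qed.

(** The maps of this form are closed under composition and contain the
    generators of the holomorph. *)
Lemma Hol_affine (s : {perm G}) :
  s \in Hol G -> forall x, s x = (s 1 - s 0) * x + s 0.
Proof.
pose A := [set s : {perm G} | [forall x, s x == (s 1 - s 0) * x + s 0]].
have affA (t : {perm G}) : reflect (forall x, t x = (t 1 - t 0) * x + t 0) (t \in A).
  by rewrite inE; apply/eqfunP.
have gA : group_set A.
  apply/group_setP; split=> [|t u /affA tA /affA uA].
    by apply/affA=> x; rewrite !perm1 subr0 addr0 mul1r.
  by apply/affA=> x; rewrite !permM uA (uA (t 1)) (uA (t 0)) (tA x); ring.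
suff /subsetP sub : (Hol G : {set {perm G}}) \subset Group gA.
  by move/sub/affA.
rewrite gen_subG; apply/subsetP=> t /setUP[/imsetP[g _ ->]|tA]; apply/affA=> x.
  by rewrite !permE /=; ring.
by rewrite Aut_zmod0 // subr0 addr0 -Aut_mul.
Qed.

Lemma card_Zpn : #|G| = (p ^ n)%N.
Proof. by rewrite card_ord Zp_cast. Qed.

(** By Fermat, m^(p^n) = m modulo p. *)
Lemma expr_eq1_pmultiples (m : G) : m ^+ (p ^ n) = 1 -> m - 1 \in pmultiples 1.
Proof.
move=> m1; rewrite -[m]natr_Zpn -[1 in X in X \in _]/(1%:R).
rewrite mem_natrB_pmultiples // expn1.
have fermat (i k : nat) : (i ^ (p ^ k) = i %[mod p])%N.
  elim: k => [|k IHk]; first by rewrite expn1.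
  by rewrite expnSr expnM fermat_little.
rewrite -(fermat _ n).
apply/eqP; have : (val m ^ (p ^ n))%N == 1%N %[mod p ^ n].
  by rewrite -natr_eqZ // natrX natr_Zpn m1.
have dp : (p %| p ^ n)%N by rewrite dvdn_exp.
by move/eqP=> E; rewrite -(modn_dvdm _ dp) E modn_dvdm.
Qed.

(** Two equal partial sums with i <= j terms differ by m^i times the sum of
    j - i terms, so p^n divides j - i. The first p^n partial sums are thus
    distinct and fill G. *)
Lemma geometric_sum_surj (m g : G) :
  m - 1 \in pmultiples 1 -> exists k : nat, g = \sum_(l < k) m ^+ l.
Proof.
move=> pm; pose S (k : 'I_(p ^ n)) := \sum_(l < k) m ^+ l.
have Um : m \is a GRing.unit.
  by case/imsetP: pm => b _ Db; rewrite -(subrK 1 m) Db gamma_u_unit.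
have m1 : (val m = 1 %[mod p])%N.
  have := pm; rewrite -{1}[m]natr_Zpn -[1 in X in X \in _]/(1%:R).
  by rewrite mem_natrB_pmultiples // expn1 => /eqP.
have injS : injective S.
  move=> i j; wlog le_ij : i j / (i <= j)%N.
    by move=> IH; case/orP: (leq_total i j) => /IH // E /esym/E.
  rewrite /S -(subnKC le_ij) geometric_sumD -[LHS]addr0 => /addrI/esym/eqP.
  rewrite mulrI_eq0; last exact/mulrI/unitrX.
  have <- : (\sum_(l < j - i) val m ^ l)%:R = \sum_(l < j - i) m ^+ l.
    by rewrite natr_sum; apply: eq_bigr => l _; rewrite natrX natr_Zpn.
  rewrite natr_eq0Z // => /(dvdn_geometric_sum p_pr p_odd m1).
  move=> dv; apply/val_inj/eqP; rewrite eqn_leq le_ij -subn_eq0 /=.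
  rewrite -(@modn_small (j - i) (p ^ n)) //.
  exact: leq_ltn_trans (leq_subr _ _) (ltn_ord j).
have [|k ->] := codomP (inj_card_onto injS _ g); last by exists k.
by rewrite card_Zpn card_ord.
Qed.

(** N is generated by its element s sending 0 to 1. The translation part of
    s^k is the k-th partial sum g of the powers of the multiplier m of s, and
    m^k = (m - 1) g + 1, so every element of N_(m - 1) is a power of s. Equality
    follows by cardinality. *)
Lemma lng_vertexP (N : {set {perm G}}) : N \in lng_vertices G ->
  exists2 a, a \in pmultiples 1 & N = affine_subgroup a.
Proof.
case/imsetP=> K; rewrite inE => /andP[/subsetP KH regK] ->.
have oK := card_regular regK; have /andP[trK _] := regK.
have [s sK s0] := atransP2 trK (in_setT 0) (in_setT 1).
pose m := s 1 - s 0; have Ds x : s x = m * x + 1.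
  by rewrite (Hol_affine (KH s sK)) -/m [s 0](esym s0).
have Dsk k x : (s ^+ k)%g x = m ^+ k * x + \sum_(l < k) m ^+ l.
  elim: k x => [|k IHk] x; first by rewrite expg0 perm1 mul1r big_ord0 addr0.
  by rewrite expgS permM IHk Ds exprSr big_ord_recr /=; ring.
have sp : (s ^+ (p ^ n) = 1)%g.
  by have := expg_cardG sK; rewrite oK card_Zpn.
have pm : m - 1 \in pmultiples 1.
  apply: expr_eq1_pmultiples.
  have := Dsk (p ^ n)%N 1; have := Dsk (p ^ n)%N 0.
  by rewrite sp !perm1 mulr0 add0r mulr1 => <-; rewrite addr0.
exists (m - 1) => //; apply/esym/eqP.
rewrite eqEcard oK card_gamma_subgroup ?leqnn ?andbT; last first.
  exact: gamma_function_affine.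
apply/subsetP=> t /mem_affine_subgroup[] // g Dt.
have [k Dg] := geometric_sum_surj g pm.
suff -> : t = (s ^+ k)%g by apply: groupX.
apply/permP=> x; rewrite Dt Dsk {1}Dg -subrX1 subrK -Dg //.
Qed.

(** * The components as sets of parameters *)

Lemma affine_family_component (P : {set G}) (a0 : G) :
    {subset P <= pmultiples 1} -> a0 \in P ->
    (forall a b, a \in P -> b \in pmultiples 1 ->
       (b \in P) = (a * (b - a) == 0) && (b * (b - a) == 0)) ->
  lng_component (affine_subgroup @: P) /\ lng_clique (affine_subgroup @: P).
Proof.
move=> sP Pa0 adjP.
have cl : lng_clique (affine_subgroup @: P).
  split=> [|_ _ /imsetP[a Pa ->] /imsetP[b Pb ->] neq].
    by apply/subsetP=> _ /imsetP[a /sP pa ->]; apply: affine_subgroup_vertex.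
  rewrite affine_subgroup_edge ?sP // -adjP ?sP // Pb andbT.
  by apply: contraNneq neq => ->.
split=> //; apply: lng_component_clique (imset_f _ Pa0) cl _.
move=> _ /imsetP[a Pa ->] M e.
have /lng_vertexP[b pb DM] : M \in lng_vertices G by case/and5P: e.
have pa := sP a Pa.
move: e; rewrite DM affine_subgroup_edge // -adjP // => /andP[_ Pb].
exact: imset_f.
Qed.

(** A nonzero parameter a is p^u e with e prime to p; k and c are the quotient
    and the remainder of e by p. *)
Lemma H_subgroupsE :
  H_subgroups p n = affine_subgroup @: pmultiples (uphalf n).
Proof.
have le_mn : (uphalf n <= n)%N by lia.
apply/setP=> M; apply/imsetP/imsetP=> [[gam]|[a]].
  rewrite inE => /existsP[u /existsP[k /existsP[c /and3P[le_mu _ /eqP ->]]]] ->.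
  exists ((p ^ u)%:R * (k * p + c)%:R); last exact: affine_subgroup_ukc.
  by apply: (sub_pmultiples le_mu); apply: imset_f.
move=> pa ->; suff [u [k [c [le_un le_mu lt_k c_gt0 [lt_c Da]]]]] : exists u k c,
    [/\ (u <= n)%N, (uphalf n <= u)%N, (k < p ^ n.-1)%N, (0 < c)%N & (c < p)%N
      /\ a = (p ^ u)%:R * (k * p + c)%:R].
  exists (gamma_ukc p n u k c); last by rewrite affine_subgroup_ukc Da.
  rewrite inE; apply/existsP; exists (inord u); apply/existsP.
  exists (Ordinal lt_k); apply/existsP; exists (Ordinal lt_c) => /=.
  by rewrite inordK ?ltnS // le_mu c_gt0 eqxx.
have [-> | a_neq0] := eqVneq a 0.
  (* N_0 is the subgroup of the trivial gamma_n *)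
  exists n, 0%N, 1%N; rewrite expn_gt0 p_gt0; split=> //; split=> //.
  by rewrite -natrM; apply/esym/eqP; rewrite natr_eq0Z // dvdn_mulr.
have va_gt0 : (0 < val a)%N by rewrite lt0n; apply: contra a_neq0 => /eqP E; apply/eqP/val_inj.
have [e e'p De] := pfactor_coprime p_pr va_gt0.
set u := logn p (val a) in De.
have lt_a : (val a < p ^ n)%N by have := ltn_ord a; rewrite [X in (_ < X)%N]Zp_cast.
have lt_un : (u < n)%N.
  rewrite -(ltn_exp2l _ _ p_gt1); apply: leq_ltn_trans lt_a.
  by rewrite dvdn_leq // pfactor_dvdnn.
exists u, (e %/ p)%N, (e %% p)%N; rewrite -divn_eq; split.
- exact: ltnW.
- move: pa; rewrite -[a]natr_Zpn mem_natr_pmultiples //.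
  by rewrite pfactor_dvdn.
- rewrite ltn_divLR // -expnSr prednK //; apply: leq_ltn_trans lt_a.
  by rewrite De leq_pmulr // expn_gt0 p_gt0.
- by rewrite lt0n; move: e'p; rewrite prime_coprime.
split; first by rewrite ltn_mod.
by rewrite -natrM mulnC -De natr_Zpn.
Qed.

(** These cosets are the parameter sets of the small components. *)
Definition pcoset (a : G) (k : nat) : {set G} := [set a + x | x in pmultiples k].

Lemma mem_pcoset a k x : (x \in pcoset a k) = (x - a \in pmultiples k).
Proof.
apply/imsetP/idP=> [[y py ->]|px]; first by rewrite addrC addKr.
by exists (x - a); rewrite // addrC subrK.
Qed.

Lemma card_pcoset a k : (k <= n)%N -> #|pcoset a k| = (p ^ (n - k))%N.
Proof.
by move=> le_kn; rewrite card_imset ?card_pmultiples //; apply: addrI.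
Qed.

Definition A_base (u t c : nat) : G := (p ^ u)%:R * (t * p + c)%:R.

(** Adding p^(n - 2u - 1) j to t adds p^(n - u) j to p^u (t p + c), because
    u + 1 + (n - 2u - 1) = n - u. *)
Lemma A_subgroupsE (u t c : nat) :
    (0 < u < uphalf n)%N -> (t < p ^ (n - 2 * u - 1))%N ->
  A_subgroups p n u t c = affine_subgroup @: pcoset (A_base u t c) (n - u).
Proof.
move=> /andP[u_gt0 lt_um] lt_t.
have ltun : (2 * u < n)%N by lia.
have Dnu : (n - u = u + (1 + (n - 2 * u - 1)))%N by lia.
rewrite /A_subgroups; apply/setP=> M; apply/imsetP/imsetP.
  case=> gam /imsetP[k]; rewrite inE => k_t -> ->.
  exists ((p ^ u)%:R * (k * p + c)%:R); last exact: affine_subgroup_ukc.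
  rewrite mem_pcoset -mulrBr Dnu pmultiplesMr //; last by lia.
  rewrite mem_natrB_pmultiples //; last by lia.
  by rewrite eqn_modDr expnD expn1 (mulnC p) -!muln_modl eqn_pmul2r.
case=> a; rewrite mem_pcoset => pa ->.
have lt_nu : (n - u <= n)%N by lia.
have [j lt_j Da] : exists2 j : nat, (j < p ^ u)%N
    & a - A_base u t c = (p ^ (n - u) * j)%:R.
  move: pa; rewrite pmultiplesE // => /imsetP[j _ ->]; exists j => //.
  by apply: leq_trans (ltn_ord j) _; rewrite leq_exp2l //; lia.
pose k := (t + p ^ (n - 2 * u - 1) * j)%N.
have lt_k : (k < p ^ n.-1)%N.
  apply: (@leq_trans (p ^ (n - 2 * u - 1 + u))); last by rewrite leq_exp2l //; lia.
  rewrite expnD; apply: (@leq_trans (p ^ (n - 2 * u - 1) * j.+1)).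
    by rewrite mulnS ltn_add2r.
  by rewrite leq_mul2l lt_j orbT.
exists (gamma_ukc p n u k c).
  apply/imsetP; exists (Ordinal lt_k) => //=; rewrite inE /= /k.
  by rewrite addnC mulnC modnMDl.
rewrite affine_subgroup_ukc; congr (affine_subgroup _).
rewrite -[LHS](subrK (A_base u t c)) Da /A_base -!natrM -natrD /k Dnu !expnD expn1.
congr (_%:R); ring.
Qed.

(** * The large component *)

Lemma unit_pmultiples (w : G) : (w \is a GRing.unit) = (w \notin pmultiples 1).
Proof.
rewrite -[w]natr_Zpn unitZpE // mem_natr_pmultiples // expn1.
by rewrite coprime_pexpl // prime_coprime.
Qed.

Lemma pmultiplesMl (k : nat) (w x : G) :
  x \in pmultiples k -> w * x \in pmultiples k.
Proof. by case/imsetP=> y _ ->; rewrite mulrCA imset_f. Qed.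

Lemma card_affine_family (P : {set G}) :
  {subset P <= pmultiples 1} -> #|affine_subgroup @: P| = #|P|.
Proof.
move=> sP; rewrite card_in_imset // => a b /sP pa /sP pb.
exact: affine_subgroup_inj.
Qed.

(** If a (b - a) = b (b - a) = 0 then (b - a)^2 = 0, which forces b - a into
    p^m G with m = ceil(n/2). *)
Lemma H_subgroups_spec :
  [/\ lng_component (H_subgroups p n), lng_clique (H_subgroups p n)
    & #|H_subgroups p n| = (p ^ (n - uphalf n))%N].
Proof.
set m := uphalf n; have m_gt0 : (0 < m)%N by rewrite /m; lia.
have le_mn : (m <= n)%N by rewrite /m; lia.
have le_n2m : (n <= m + m)%N by rewrite /m; lia.
have sP : {subset pmultiples m <= pmultiples 1} by apply: sub_pmultiples.
have mul0 a b : a \in pmultiples m -> b \in pmultiples m -> a * b = 0.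
  case/imsetP=> x _ -> /imsetP[y _ ->]; rewrite mulrACA -natrM -expnD.
  apply/eqP; rewrite -pmultiplesn //; apply: (sub_pmultiples le_n2m).
  exact: imset_f.
rewrite H_subgroupsE // card_affine_family // card_pmultiples //.
have [|//] := affine_family_component sP (pmultiples0 m).
move=> a b Pa pb; apply/idP/andP=> [Pb | [/eqP aba0 /eqP bba0]].
  by rewrite !mul0 // pmultiplesB.
have: (b - a) * (b - a) == 0 by rewrite mulrBl aba0 bba0 subr0.
rewrite -[b - a]natr_Zpn -natrM natr_eq0Z // mulnn => /(dvdn_square p_pr).
by rewrite -mem_natr_pmultiples // natr_Zpn => /pmultiplesD/(_ Pa); rewrite subrK.
Qed.

(** * The components of a fixed level u *)

Section Level.
Variables u t c : nat.
Hypotheses (lt_um : (0 < u < uphalf n)%N) (lt_t : (t < p ^ (n - 2 * u - 1))%N).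
Hypothesis (lt_c : (0 < c < p)%N).

(** Since n - u > u, adding a multiple of p^(n - u) to p^u (t p + c) changes the
    cofactor of p^u only by a multiple of p. *)
Lemma A_base_coset_unit (a : G) : a \in pcoset (A_base u t c) (n - u) ->
  exists2 w : G, w \is a GRing.unit & a = (p ^ u)%:R * w.
Proof.
rewrite mem_pcoset => /imsetP[x _ Da].
exists ((t * p + c)%:R + (p ^ (n - 2 * u))%:R * x); last first.
  have Dnu : (n - u = u + (n - 2 * u))%N by lia.
  by rewrite mulrDr -[a](subrK (A_base u t c)) Da addrC Dnu expnD natrM mulrA.
have ltun : (0 < n - 2 * u)%N by lia.
rewrite unit_pmultiples; apply/negP=> pw.
have px : (p ^ (n - 2 * u))%:R * x \in pmultiples 1.
  by apply: (sub_pmultiples ltun); apply: imset_f.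
have := pmultiplesB pw px; rewrite addrK mem_natr_pmultiples // expn1.
by rewrite dvdn_addr ?dvdn_mull // gtnNdvd //; case/andP: lt_c.
Qed.

Lemma sub_A_base_coset : {subset pcoset (A_base u t c) (n - u) <= pmultiples 1}.
Proof.
move=> a /A_base_coset_unit[w _ ->]; apply: (@sub_pmultiples 1 u); first by lia.
exact: imset_f.
Qed.

Lemma A_base_in_coset : A_base u t c \in pcoset (A_base u t c) (n - u).
Proof. by rewrite mem_pcoset subrr pmultiples0. Qed.

(** The annihilator of p^u times a unit is p^(n - u) G. *)
Lemma A_base_coset_ann (a z : G) : a \in pcoset (A_base u t c) (n - u) ->
  (a * z == 0) = (z \in pmultiples (n - u)).
Proof.
case/A_base_coset_unit=> w Uw ->; rewrite -mulrA -pmultiplesn //.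
have Dn : (u + (n - u) = n)%N by lia.
rewrite -[X in _ \in pmultiples X]Dn pmultiplesMr //; last by rewrite Dn.
apply/idP/idP; last exact: pmultiplesMl.
by move/(pmultiplesMl w^-1); rewrite mulKr.
Qed.

Lemma A_subgroups_spec :
  [/\ lng_component (A_subgroups p n u t c), lng_clique (A_subgroups p n u t c)
    & #|A_subgroups p n u t c| = (p ^ u)%N].
Proof.
have sP := sub_A_base_coset.
rewrite A_subgroupsE // card_affine_family // card_pcoset //; last by lia.
have -> : (n - (n - u) = u)%N by lia.
have [|//] := affine_family_component sP A_base_in_coset.
move=> a b Pa pb.
have ab : (b \in pcoset (A_base u t c) (n - u)) = (b - a \in pmultiples (n - u)).
  move: Pa; rewrite !mem_pcoset => Pa; apply/idP/idP=> [Pb|].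
    by have := pmultiplesB Pb Pa; rewrite opprB addrA subrK.
  by move=> Pb; have := pmultiplesD Pb Pa; rewrite addrA subrK.
rewrite A_base_coset_ann // -ab; case Pb: (b \in _) => //=.
by rewrite A_base_coset_ann // -ab Pb.
Qed.

(** N_0 is in H, whereas the parameters of the A_u^(t,c) are p^u times a unit
    with u < n, hence nonzero. *)
Lemma H_neq_A_subgroups : H_subgroups p n != A_subgroups p n u t c.
Proof.
apply/eqP; rewrite H_subgroupsE // A_subgroupsE // => /setP/(_ (affine_subgroup 0)).
rewrite imset_f ?pmultiples0 // => /esym/imsetP[b Pb].
move/affine_subgroup_inj=> /(_ (pmultiples0 _) (sub_A_base_coset Pb)) b0.
have := A_base_coset_ann 1 Pb; rewrite -b0 mul0r eqxx => /esym.
rewrite -[1]/(1%:R) mem_natr_pmultiples //; last by lia.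
by rewrite dvdn1 -(expn0 p) eqn_exp2l //; lia.
Qed.

End Level.

(** * The number of components *)

(** The level u is recovered from the size p^u of the component. The residue
    t p + c modulo p^(n - 2u) is then determined by the coset, and it is its own
    reduced representative, of which t and c are the quotient and the remainder
    by p. *)
Lemma A_subgroups_inj u t c u' t' c' :
    (0 < u < uphalf n)%N -> (t < p ^ (n - 2 * u - 1))%N -> (0 < c < p)%N ->
    (0 < u' < uphalf n)%N -> (t' < p ^ (n - 2 * u' - 1))%N -> (0 < c' < p)%N ->
    A_subgroups p n u t c = A_subgroups p n u' t' c' ->
  [/\ u = u', t = t' & c = c'].
Proof.
move=> lt_u lt_t lt_c lt_u' lt_t' lt_c' eqA.
have [_ _ oA] := A_subgroups_spec lt_u lt_t lt_c.
have [_ _] := A_subgroups_spec lt_u' lt_t' lt_c'.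
rewrite -eqA oA => /eqP; rewrite eqn_exp2l // => /eqP Du.
move: eqA lt_t' {lt_u'}; rewrite -{u'}Du => eqA lt_t'.
have : affine_subgroup (A_base u t c)
    \in affine_subgroup @: pcoset (A_base u t' c') (n - u).
  by rewrite -A_subgroupsE // -eqA A_subgroupsE // imset_f // A_base_in_coset.
case/imsetP=> b Pb /affine_subgroup_inj Db.
have {}Db : A_base u t c = b.
  apply: Db => //; last exact: sub_A_base_coset Pb.
  exact: (sub_A_base_coset lt_u lt_t lt_c (A_base_in_coset _ _ _)).
have Dnu : (n - u = u + (n - 2 * u))%N by lia.
move: Pb; rewrite -Db mem_pcoset -mulrBr Dnu pmultiplesMr //; last by lia.
rewrite mem_natrB_pmultiples //; last by lia.
have lt_e s d : (s < p ^ (n - 2 * u - 1))%N -> (0 < d < p)%N ->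
    (s * p + d < p ^ (n - 2 * u))%N.
  move=> lt_s /andP[_ lt_d]; have -> : (n - 2 * u = (n - 2 * u - 1).+1)%N by lia.
  apply: (@leq_trans (s.+1 * p)); first by rewrite mulSn addnC ltn_add2r.
  by rewrite expnSr leq_mul2r lt_s orbT.
rewrite !modn_small ?lt_e // => /eqP E.
have [_ ltc] := andP lt_c; have [_ ltc'] := andP lt_c'.
split=> //.
  by have := congr1 (divn^~ p) E; rewrite /= !divnMDl // !divn_small // !addn0.
by have := congr1 (modn^~ p) E; rewrite /= !modnMDl !modn_small.
Qed.

(** Telescoping: p^2 - 1 = (p + 1) (p - 1). *)
Lemma sum_level_sizes j : (2 * j < n)%N ->
  ((p + 1) * (\sum_(u < j) p ^ (n - 2 * u.+1 - 1) * p.-1) + p ^ (n - 1 - 2 * j)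
     = p ^ (n - 1))%N.
Proof.
elim: j => [|j IHj] lt_jn; first by rewrite big_ord0 muln0 muln0 subn0.
rewrite -IHj; last by lia.
rewrite big_ord_recr /= mulnDr -addnA; congr (_ + _)%N.
have -> : (n - 1 - 2 * j = (n - 2 * j.+1 - 1).+2)%N by lia.
have -> : (n - 1 - 2 * j.+1 = n - 2 * j.+1 - 1)%N by lia.
have pp : (p * p = (p + 1) * p.-1 + 1)%N by nia.
by rewrite !expnS [RHS]mulnA pp; ring.
Qed.

(** The ordinals indexing u and c start at 0, whence the shifts by one. *)
Lemma card_A_family :
  #|A_family p n| = (\sum_(u < (uphalf n).-1) p ^ (n - 2 * u.+1 - 1) * p.-1)%N.
Proof.
pose T (u : 'I_(uphalf n).-1) : finType :=
  ('I_(p ^ (n - 2 * u.+1 - 1)) * 'I_p.-1)%type.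
pose f (x : {u : 'I_(uphalf n).-1 & T u}) :=
  A_subgroups p n (tag x).+1 (tagged x).1 (tagged x).2.+1.
have lt_u (u : 'I_(uphalf n).-1) : (0 < u.+1 < uphalf n)%N.
  by have := ltn_ord u; lia.
have lt_c (c : 'I_p.-1) : (0 < c.+1 < p)%N by have := ltn_ord c; lia.
have injf : injective f.
  move=> [u [t c]] [u' [t' c']] /A_subgroups_inj[]; rewrite ?lt_u ?lt_c ?ltn_ord //=.
  move=> [/val_inj Du]; case: u' / Du t' c' => t' c' /val_inj -> [/val_inj ->].
  by [].
have -> : A_family p n = f @: [set: {u : 'I_(uphalf n).-1 & T u}].
  apply/setP=> C; rewrite inE; apply/existsP/imsetP.
    case=> u /existsP[t /existsP[c /and3P[u_gt0 c_gt0 /eqP ->]]].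
    have lt_u1 : (u.-1 < (uphalf n).-1)%N by have := ltn_ord u; lia.
    have lt_c1 : (c.-1 < p.-1)%N by have := ltn_ord c; lia.
    have lt_t1 : (t < p ^ (n - 2 * u.-1.+1 - 1))%N by rewrite prednK.
    exists (Tagged T ((Ordinal lt_t1, Ordinal lt_c1) : T (Ordinal lt_u1))) => //.
    by rewrite /f /= !prednK.
  case=> -[u [t c]] _ ->; have /andP[_ lt_u1] := lt_u u.
  have /andP[_ lt_c1] := lt_c c.
  exists (Ordinal lt_u1); apply/existsP; exists t; apply/existsP.
  by exists (Ordinal lt_c1) => /=.
rewrite card_imset // cardsT card_tagged sumnE big_map big_enum /=.
by apply: eq_bigr => u _; rewrite card_prod !card_ord.
Qed.

Lemma rat_card_A_family :
  #|A_family p n|%:R = (p%:R + 1)^-1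
      * (p%:R ^+ (n - 1) - p%:R ^+ (n + 1 - 2 * uphalf n)) :> rat.
Proof.
have p1_neq0 : p%:R + 1 != 0 :> rat by rewrite natr1 Num.Theory.pnatr_eq0.
apply: (mulfI p1_neq0); rewrite mulrA divff // mul1r.
have lt_jn : (2 * (uphalf n).-1 < n)%N by lia.
rewrite -!natrX -(sum_level_sizes lt_jn) -card_A_family.
have -> : (n + 1 - 2 * uphalf n = n - 1 - 2 * (uphalf n).-1)%N by lia.
by rewrite natrD addrK natrM natrD.
Qed.

End Cyclic.

Theorem theorem5p19 (p n : nat) (p_prime : prime p) (p_odd : odd p)
    (n_gt0 : (0 < n)%N) :
  [/\ lng_component (H_subgroups p n),
      lng_clique (H_subgroups p n)
    & #|H_subgroups p n| = (p ^ (n - uphalf n))%N]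
  /\
  [/\ forall u t c : nat,
        (1 <= u < uphalf n)%N -> (t < p ^ (n - 2 * u - 1))%N ->
        (1 <= c < p)%N ->
        [/\ lng_component (A_subgroups p n u t c),
            lng_clique (A_subgroups p n u t c)
          & #|A_subgroups p n u t c| = (p ^ u)%N],
      (#|A_family p n|%:R =
         (p%:R + 1)^-1 * (p%:R ^+ (n - 1) - p%:R ^+ (n + 1 - 2 * uphalf n))
         :> rat)%R
    & H_subgroups p n \notin A_family p n].
Proof.
split; first exact: H_subgroups_spec.
split=> [u t c lt_u lt_t lt_c||]; first exact: A_subgroups_spec.
  exact: rat_card_A_family.
rewrite inE; apply/existsP=> -[u /existsP[t /existsP[c /and3P[u_gt0 c_gt0]]]].
by apply/negP/H_neq_A_subgroups; rewrite ?u_gt0 ?c_gt0 ?ltn_ord.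
Qed.
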